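(* Let $K\ge 1$ and $N\ge 1$ be integers. Define tuples $R_0,R_1,\dots,R_N$, each consisting of $K+1$ finite lists $R_n=(L^{(n)}_0,L^{(n)}_1,\dots,L^{(n)}_K)$ whose entries are finite lists of natural numbers, as follows. $R_0$ has $L^{(0)}_0=[\,[\,]\,]$ (the list containing only the empty list) and $L^{(0)}_k=[\,]$ (the empty list) for $1\le k\le K$. For $1\le n\le N$, $R_n$ is obtained from $R_{n-1}$ by $$L^{(n)}_0=[\,[\,]\,],\qquad L^{(n)}_k \;=\; L^{(n-1)}_k \;+\!\!+\; \mathit{reverse}\big(\mathit{map}(\,\cdot +\!\!+ [n],\;L^{(n-1)}_{k-1})\big)\quad (1\le k\le K),$$ where $+\!\!+$ is list concatenation, $\mathit{map}(\,\cdot +\!\!+[n], L)$ appends the element $n$ to the end of every list in $L$ (preserving the order of $L$), and $\mathit{reverse}$ reverses the order of a list. Then for every $1\le k\le K$, the list $L^{(N)}_k$ contains every $k$-element subset of $\{1,\dots,N\}$ exactly once (each represented as a list of its elements), and it is in revolving door order: any two consecutive entries of $L^{(N)}_k$, regarded as sets, differ by exactly two elements (i.e. their symmetric difference has size $2$, so one is obtained from the other by removing one element and inserting another), and, if $L^{(N)}_k$ has at least two entries, its last entry and its first entry also differ by exactly two elements in this sense.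
   Context: This is the sequential ''revolving door'' recursion $\mathit{kcombs}(K,[N,N-1,\dots,1])=\mathit{for}_{\text{revol}}(N,\mathit{kcombs}(K,[N-1,\dots,1]))$ with $\mathit{kcombs}(K,[\,])=[[[\,]],[\,]^K]$ and $\mathit{for}_{\text{revol}}(x,(\mathit{cs}_0,\dots,\mathit{cs}_K))=[[[\,]]]\cup[\mathit{cs}_k\cup\mathit{reverse}(\mathit{map}(\cup[x],\mathit{cs}_{k-1}))\mid k\leftarrow[1,\dots,K]]$; the $k$-th entry (indexing from $0$) of the output is denoted $\mathit{cs}_k^N$. The revolving door property means that adjacent combinations, cyclically including the last and first, differ by exactly two elements. *)

(* Defs.v *)
From mathcomp Require Import all_boot finmap.

Set Implicit Arguments.
Unset Strict Implicit.
Unset Printing Implicit Defensive.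

Local Open Scope fset_scope.

(* Here [k : 'I_K] stands for the output index k + 1: [lift ord0 k] is k + 1
   and [widen_ord _ k] is k, both as indices of the input tuple. *)
Definition for_revol (K x : nat) (cs : K.+1.-tuple (seq (seq nat))) :
    K.+1.-tuple (seq (seq nat)) :=
  cons_tuple [:: [::]]
    [tuple tnth cs (lift ord0 k)
           ++ rev [seq c ++ [:: x] | c <- tnth cs (widen_ord (leqnSn K) k)]
    | k < K].

Fixpoint kcombs (K n : nat) : K.+1.-tuple (seq (seq nat)) :=
  if n is m.+1 then for_revol n (kcombs K m)
  else cons_tuple [:: [::]] (nseq_tuple K [::]).

Definition set_of (c : seq nat) : {fset nat} := [fset x in c].

Definition ground (N : nat) : {fset nat} := [fset x in iota 1 N].

(* [uniq c] makes [c] list each element of the set it represents only once. *)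
Definition lists_ksubsets (N k : nat) (L : seq (seq nat)) : Prop :=
  (forall c, c \in L ->
     [/\ uniq c, set_of c `<=` ground N & #|` set_of c| = k]) /\
  (forall A : {fset nat}, A `<=` ground N -> #|` A| = k ->
     count (fun c => set_of c == A) L = 1).

Definition symdiff (A B : {fset nat}) : {fset nat} :=
  (A `\` B) `|` (B `\` A).

Definition differ_by_two : rel (seq nat) :=
  fun c d => #|` symdiff (set_of c) (set_of d)| == 2.

Definition revolving_door (L : seq (seq nat)) : Prop :=
  sorted differ_by_two L /\
  (1 < size L -> differ_by_two (last [::] L) (head [::] L)).

(* Main.v *)
From mathcomp Require Import all_boot finmap.
From mathcomp Require Import zify.
Require Import Defs.

Set Implicit Arguments.
Unset Strict Implicit.
Unset Printing Implicit Defensive.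

Local Open Scope fset_scope.

(** The entries of L^(n)_k are exactly the subsequences of 1, ..., n of size k,
    so that each subset is listed once, in increasing order.  For k < n the list
    L^(n)_{k+1} starts with 1, ..., k+1 and ends with 1, ..., k, n.  Hence, when
    L^(n+1)_{k+1} is formed, the only new adjacencies are between 1, ..., k, n
    and the last entry of L^(n)_k followed by n+1, and, cyclically, between
    1, ..., k, n+1 and 1, ..., k+1; in both cases a single element is
    exchanged. *)

Fixpoint revol (n k : nat) : seq (seq nat) :=
  if k is k'.+1 then
    if n is n'.+1 then revol n' k ++ rev [seq rcons c n | c <- revol n' k']
    else [::]
  else [:: [::]].

Lemma revolSS n k :
  revol n.+1 k.+1 = revol n k.+1 ++ rev [seq rcons c n.+1 | c <- revol n k].
Proof. by []. Qed.

Lemma revol0 n : revol n 0 = [:: [::]].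
Proof. by case: n. Qed.

Lemma tnth_kcombs K n (k : 'I_K.+1) : tnth (kcombs K n) k = revol n k.
Proof.
elim: n k => [|n IHn] k; case: (unliftP ord0 k) => [j|] -> //=.
- by rewrite tnthS tnth_nseq.
- rewrite tnthS tnth_mktuple !IHn /=; congr (_ ++ rev _).
  by apply: eq_map => c; rewrite cats1.
Qed.

Lemma iota1S n : iota 1 n.+1 = rcons (iota 1 n) n.+1.
Proof. by rewrite -{1}(addn1 n) iotaD add1n cats1. Qed.

(** After reversing both lists this is the defining equation of [subseq] on two nonempty lists. *)
Lemma subseq_rcons2 (T : eqType) (x y : T) s t :
  subseq (rcons s x) (rcons t y) =
  if x == y then subseq s t else subseq (rcons s x) t.
Proof.
rewrite -subseq_rev !rev_rcons /=.
by case: ifP => _; rewrite -?rev_rcons subseq_rev.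
Qed.

Lemma mem_revol n k c :
  (c \in revol n k) = subseq c (iota 1 n) && (size c == k).
Proof.
elim: n k c => [|n IHn] [|k] c.
- by rewrite inE /=; case: c.
- by case: c.
- by rewrite inE; case: c => //= a c; rewrite andbF.
rewrite revolSS mem_cat IHn mem_rev iota1S.
case/lastP: c => [|c x].
  by rewrite !sub0seq /=; apply/negbTE/mapP => -[[|a d] _].
have -> : (rcons c x \in [seq rcons d n.+1 | d <- revol n k])
    = (x == n.+1) && (c \in revol n k).
  apply/mapP/andP => [[d d_in /rcons_inj[-> ->]] //|[/eqP-> c_in]].
  by exists c.
rewrite IHn size_rcons eqSS subseq_rcons2.
case: (eqVneq x n.+1) => [->|_] /=; last by rewrite orbF.
(* A list ending in [n.+1] can only come from the reversed half. *)
suff /negbTE-> : ~~ subseq (rcons c n.+1) (iota 1 n) by [].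
apply/negP => /mem_subseq/(_ n.+1).
by rewrite mem_rcons mem_head mem_iota add1n ltnn andbF => /(_ isT).
Qed.

Lemma notin_revol n k c m : c \in revol n k -> n < m -> m \notin c.
Proof.
rewrite mem_revol => /andP[/mem_subseq sub_c _] lt_nm.
by apply/negP => /sub_c; rewrite mem_iota; lia.
Qed.

Lemma uniq_revol n k : uniq (revol n k).
Proof.
elim: n k => [|n IHn] [|k] //; rewrite revolSS cat_uniq IHn rev_uniq.
rewrite map_inj_uniq ?IHn => [|c d /rcons_inj[]] //.
rewrite andbT; apply/hasPn => c; rewrite mem_rev => /mapP[d _ ->].
apply/negP => /notin_revol/(_ (ltnSn n)).
by rewrite mem_rcons mem_head.
Qed.

Lemma in_set_of c x : (x \in set_of c) = (x \in c).
Proof. by rewrite /set_of !inE. Qed.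

Lemma card_set_of c : uniq c -> #|` set_of c| = size c.
Proof. by move=> c_uniq; rewrite /set_of card_fseq undup_id. Qed.

Lemma lists_ksubsets_revol n k : lists_ksubsets n k (revol n k).
Proof.
have iotaU := iota_uniq 1 n; split=> [c|A sAn cardA].
  rewrite mem_revol => /andP[sub_c /eqP size_c].
  have c_uniq := subseq_uniq sub_c iotaU.
  split; rewrite ?card_set_of //; apply/fsubsetP => x.
  by rewrite in_set_of /ground !inE; exact: mem_subseq.
(* The increasing enumeration of [A] is the only entry that can represent it: a subsequence of a
   duplicate-free list is determined by its elements. *)
pose a := [seq x <- iota 1 n | x \in A].
have setA : set_of a = A.
  apply/fsetP => x; rewrite in_set_of mem_filter andb_idr //.
  by move/(fsubsetP sAn); rewrite /ground !inE.
have a_in : a \in revol n k.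
  rewrite mem_revol filter_subseq /= -card_set_of ?filter_uniq //.
  by rewrite setA cardA.
transitivity (count_mem a (revol n k)); last first.
  by rewrite count_uniq_mem ?uniq_revol // a_in.
apply: eq_in_count => c; rewrite mem_revol => /andP[sub_c _] /=.
apply/eqP/eqP => [setc|->//]; rewrite (subseq_uniqP iotaU sub_c).
by apply: eq_filter => x; rewrite -setc in_set_of.
Qed.

(** Here [u] is the common part. Using [=i] leaves the position of the exchanged element free. *)
Lemma differ_by_two_exchange s t u x y :
  s =i x :: u -> t =i y :: u -> x \notin u -> y \notin u -> x != y ->
  differ_by_two s t.
Proof.
move=> s_xu t_yu xu yu neq_xy; rewrite /differ_by_two.
suff -> : symdiff (set_of s) (set_of t) = [fset x; y].
  by rewrite cardfs2 neq_xy.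
apply/fsetP => z; rewrite /symdiff !(in_fsetU, in_fsetD, in_set_of, in_fset1).
rewrite s_xu t_yu !inE.
have [-> | _] := eqVneq z x; first by rewrite (negbTE neq_xy) xu.
by have [-> | _] := eqVneq z y; rewrite ?yu //=; case: (z \in u).
Qed.

Lemma differ_by_two_sym : symmetric differ_by_two.
Proof. by move=> c d; rewrite /differ_by_two /symdiff fsetUC. Qed.

Lemma differ_by_two_rcons c d x :
  x \notin c -> x \notin d ->
  differ_by_two (rcons c x) (rcons d x) = differ_by_two c d.
Proof.
move=> xc xd; rewrite /differ_by_two; congr (#|` _| == _).
apply/fsetP => z; rewrite /symdiff !(in_fsetU, in_fsetD, in_set_of).
rewrite !mem_rcons !inE; have [->|//] := eqVneq z x.
by rewrite (negbTE xc) (negbTE xd).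
Qed.

Lemma revol_gt n k : n < k -> revol n k = [::].
Proof.
elim: n k => [|n IHn] [|k] // lt_nk.
by rewrite revolSS !IHn // ltnW.
Qed.

Lemma revol_diag n : revol n n = [:: iota 1 n].
Proof. by elim: n => // n IHn; rewrite revolSS revol_gt // IHn iota1S. Qed.

Lemma revol_neq0 n k : k <= n -> revol n k != [::].
Proof.
move=> le_kn; apply/eqP => r0.
have := mem_revol n k (iota 1 k).
rewrite r0 size_iota eqxx andbT in_nil => /esym/negP[].
by rewrite -(subnKC le_kn) iotaD prefix_subseq.
Qed.

Lemma head_revol n k : k <= n -> head [::] (revol n k) = iota 1 k.
Proof.
elim: n k => [|n IHn] [|k] //.
(* On the diagonal the first half is empty and cannot supply the head; below it, the first half is
   nonempty and keeps its head. *)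
rewrite leq_eqVlt => /predU1P[[->]|lt_kn]; first by rewrite revol_diag.
rewrite revolSS -IHn //.
by have := @revol_neq0 n k.+1 lt_kn; case: (revol n k.+1).
Qed.

Lemma last_rev (T : Type) (x : T) s : last x (rev s) = head x s.
Proof. by case: s => //= y s; rewrite rev_cons last_rcons. Qed.

Lemma head_rev (T : Type) (x : T) s : head x (rev s) = last x s.
Proof. by rewrite -last_rev revK. Qed.

(** Reversal moves the extension of the first entry of the shorter combinations to the end. *)
Lemma last_revol n k : k < n -> last [::] (revol n k.+1) = rcons (iota 1 k) n.
Proof.
case: n => // n le_kn; rewrite revolSS last_cat last_rev.
have := @head_revol n k le_kn; have := @revol_neq0 n k le_kn.
by case: (revol n k) => //= c L _ ->.
Qed.

Lemma sorted_cat (T : Type) (e : rel T) x s t :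
  sorted e s -> sorted e t ->
  (s <> [::] -> t <> [::] -> e (last x s) (head x t)) -> sorted e (s ++ t).
Proof.
case: s => //= a s; rewrite cat_path => -> /=.
by case: t => //= b t -> ->.
Qed.

Lemma sorted_revol n k : sorted differ_by_two (revol n k).
Proof.
elim: n k => [|n IHn] [|k] //; rewrite revolSS.
apply: (@sorted_cat _ _ [::]) => //.
  (* Symmetry of the relation makes reversal harmless, and the fresh element [n.+1] cancels in
     symmetric differences. *)
  rewrite rev_sorted (eq_sorted (e' := differ_by_two)); last first.
    by move=> c d; rewrite differ_by_two_sym.
  rewrite sorted_map; apply: (sub_in_sorted (P := mem (revol n k)) _ _ (IHn k)).
    move=> c d c_in d_in /=.
    by rewrite differ_by_two_rcons // (@notin_revol n k).
  exact/allP.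
move=> r_neq0 _.
have lt_kn : k < n.
  by rewrite ltnNge; apply/negP => /(@revol_gt n k.+1).
rewrite last_revol // head_rev.
have -> : last [::] [seq rcons c n.+1 | c <- revol n k]
    = rcons (last [::] (revol n k)) n.+1.
  have := revol_neq0 (ltnW lt_kn).
  by case: (revol n k) => //= c L _; rewrite (last_map (rcons^~ n.+1)).
(* The junction is between [[:: n]] and [[:: n.+1]] when [k] is 0. Otherwise both sides contain [n]
   and 1, ..., [j], and [j.+1] is exchanged for [n.+1]; [lt_kn] makes [j.+1] differ from [n]. *)
case: k => [|j] in r_neq0 lt_kn *.
  by rewrite revol0; apply: (@differ_by_two_exchange _ _ [::] n n.+1) => //; lia.
rewrite last_revol ?(ltnW lt_kn) // iota1S.
apply: (@differ_by_two_exchange _ _ (n :: iota 1 j) j.+1 n.+1).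
- by move=> z; rewrite !(mem_rcons, inE) orbCA.
- by move=> z; rewrite !(mem_rcons, inE).
- by rewrite !inE mem_iota; lia.
- by rewrite !inE mem_iota; lia.
- lia.
Qed.

Lemma revolving_door_revol n k : 0 < k -> revolving_door (revol n k).
Proof.
case: k => // k _; split; first exact: sorted_revol.
(* The list is empty if [n < k.+1] and a singleton if [n = k.+1]; only [k.+1 < n] leaves a cyclic
   adjacency to check. *)
case: (ltngtP n k.+1) => [lt_nk|lt_kn|->]; rewrite ?revol_diag //.
  by rewrite revol_gt.
rewrite (last_revol (ltnW lt_kn)) (head_revol (ltnW lt_kn)) iota1S => _.
apply: (@differ_by_two_exchange _ _ (iota 1 k) n k.+1).
- by move=> z; rewrite !(mem_rcons, inE).
- by move=> z; rewrite !(mem_rcons, inE).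
- by rewrite mem_iota; lia.
- by rewrite mem_iota; lia.
- lia.
Qed.

Theorem theorem1 (K N : nat) (hK : 1 <= K) (hN : 1 <= N)
    (k : 'I_K.+1) (hk : 1 <= k) :
  lists_ksubsets N k (tnth (kcombs K N) k) /\
  revolving_door (tnth (kcombs K N) k).
Proof.
rewrite tnth_kcombs; split; first exact: lists_ksubsets_revol.
exact: revolving_door_revol.
Qed.
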